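(* Let $f=(f_1,\dots,f_s)$ be a finite family of polynomials in $\mathbb{R}[x_1,\dots,x_d]$, and assume that the preordering $T(f)$ is Archimedean. If $L:\mathbb{R}[x_1,\dots,x_d]\to\mathbb{R}$ is a $T(f)$-positive linear functional, then $L$ is a $K(f)$-moment functional.
   Context: Let $\sum\mathbb{R}[x_1,\dots,x_d]^2$ denote the set of finite sums of squares of polynomials in $\mathbb{R}[x_1,\dots,x_d]$. For a finite family $f=(f_1,\dots,f_s)$ in $\mathbb{R}[x_1,\dots,x_d]$, set $K(f)=\{x\in\mathbb{R}^d: f_i(x)\ge 0 \text{ for } i=1,\dots,s\}$ and $$T(f)=\Bigl\{\sum_{e\in\{0,1\}^s}\sigma_e f_1^{e_1}\cdots f_s^{e_s}:\ \sigma_e\in\sum\mathbb{R}[x_1,\dots,x_d]^2\Bigr\}$$ (the preordering generated by $f$). $T(f)$ is Archimedean if for every $a\in\mathbb{R}[x_1,\dots,x_d]$ there exists $\lambda>0$ such that both $\lambda+a$ and $\lambda-a$ belong to $T(f)$. A linear functional $L:\mathbb{R}[x_1,\dots,x_d]\to\mathbb{R}$ is $T(f)$-positive if $L(h)\ge 0$ for every $h\in T(f)$. For $K\subseteq\mathbb{R}^d$, a linear functional $L$ is a $K$-moment functional if there is a nonnegative Radon measure $\mu$ on $\mathbb{R}^d$, supported on $K$, with $L(p)=\int_K p\,d\mu$ for all $p\in\mathbb{R}[x_1,\dots,x_d]$. *)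

(* Defs.v *)
From HB Require Import structures.
From mathcomp Require Import all_boot all_order all_algebra.
From mathcomp Require Import all_classical all_reals all_analysis.
(* The notations of mpoly clash with those of MathComp-Analysis. *)
From mathcomp.multinomials Require Import -(notations) mpoly.

Set Implicit Arguments.
Unset Strict Implicit.
Unset Printing Implicit Defensive.

Import Order.TTheory GRing.Theory Num.Theory.
Import numFieldNormedType.Exports.

Local Open Scope classical_set_scope.
Local Open Scope ring_scope.

Notation "{ 'mpoly' T [ n ] }" := (mpoly n T).

Section Preordering.
Variables (R : realType) (d : nat).
Implicit Types (s : nat) (L : {scalar {mpoly R[d]}}).

Definition evalp (p : {mpoly R[d]}) (x : 'rV[R]_d) : R :=
  meval (fun i => x ord0 i) p.

Definition sos : set {mpoly R[d]} :=
  [set p | exists qs : seq {mpoly R[d]}, p = \sum_(q <- qs) q ^+ 2].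

Definition semialg s (f : 'I_s -> {mpoly R[d]}) : set 'rV[R]_d :=
  [set x | forall i, 0 <= evalp (f i) x].

(* The exponents e in {0,1}^s are booleans, coerced to nat. *)
Definition preordering s (f : 'I_s -> {mpoly R[d]}) : set {mpoly R[d]} :=
  [set h | exists2 sigma : {ffun 'I_s -> bool} -> {mpoly R[d]},
     (forall e, sos (sigma e)) &
     h = \sum_(e : {ffun 'I_s -> bool}) sigma e * \prod_(i < s) f i ^+ e i].

Definition is_archimedean (T : set {mpoly R[d]}) : Prop :=
  forall a : {mpoly R[d]}, exists2 lambda : R, 0 < lambda &
    T (mpolyC d lambda + a) /\ T (mpolyC d lambda - a).

Definition positive_on (T : set {mpoly R[d]}) L : Prop :=
  forall h, T h -> 0 <= L h.

End Preordering.

(* R^d with the sigma-algebra generated by its open sets. *)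
Notation borelRd R d := (g_sigma_algebraType (@open 'rV[R]_d)).

Section Moment.
Variables (R : realType) (d : nat).

Definition is_radon (mu : {measure set (borelRd R d) -> \bar R}) : Prop :=
  (forall C : set 'rV[R]_d, compact C -> (mu C < +oo)%E) /\
  (forall A : set (borelRd R d), measurable A ->
     mu A = ereal_sup [set mu C | C in
              [set C : set 'rV[R]_d | compact C /\ C `<=` A]]).

(* mu is supported on K: the complement of K is mu-null. The integrability of
   polynomials is part of the requirement that L p be their integral (the
   library integral also has a value on non-integrable functions). *)
Definition moment_functional (K : set 'rV[R]_d)
    (L : {scalar {mpoly R[d]}}) : Prop :=
  exists mu : {measure set (borelRd R d) -> \bar R},
    [/\ is_radon mu,
        mu.-negligible (~` K) &
        forall p : {mpoly R[d]},
          mu.-integrable K (fun x => (evalp p x)%:E) /\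
          ((L p)%:E = \int[mu]_(x in K) (evalp p x)%:E)%E].

End Moment.

(* Main.v *)
Require Import Defs.
From HB Require Import structures.
From mathcomp Require Import all_boot all_order all_algebra.
From mathcomp Require Import all_classical all_reals all_analysis.
From mathcomp.multinomials Require Import -(notations) mpoly.
From mathcomp Require Import measurable_realfun ring lra.

Set Implicit Arguments.
Unset Strict Implicit.
Unset Printing Implicit Defensive.

Import Order.TTheory GRing.Theory Num.Theory.
Import numFieldNormedType.Exports.

Local Open Scope classical_set_scope.
Local Open Scope ring_scope.

(** Bernstein polynomials replace the Positivstellensatz. As [T(f)] is
    Archimedean, it contains [l_i + x_i] and [l_i - x_i] for some [l_i > 0], hence,
    being closed under products, a partition of unity into Bernstein weights [b]
    of the cube [Q] of half-sides [l_i], with [\sum_b |x - y_b|^2 b] as small as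
    desired modulo [T(f)]. Every polynomial [p] is Lipschitz modulo [T(f)], so [L p]
    is the limit of the positive averages [\sum_b p(y_b) L(b)]. A limit of these
    averages along an ultrafilter makes sense for every continuous function and
    extends [L] to a functional which is positive on [Q]; the Riesz-Markov theorem
    turns it into a measure [mu] on [Q]. Finally [L(f_i q^2) >= 0] for all [q] forces
    [mu] to vanish where [f_i < 0]. *)

(** * The Riesz-Markov theorem on a compact set *)

Section ContinuousOperations.
Context {R : realType} {T : topologicalType}.
Implicit Types g h : T -> R.

Lemma contM g h : continuous g -> continuous h ->
  continuous (fun x => g x * h x).
Proof. by move=> cg ch x; apply: cvgM; [exact: cg|exact: ch]. Qed.

Lemma contD g h : continuous g -> continuous h ->
  continuous (fun x => g x + h x).
Proof. by move=> cg ch x; apply: cvgD; [exact: cg|exact: ch]. Qed.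

Lemma contB g h : continuous g -> continuous h ->
  continuous (fun x => g x - h x).
Proof. by move=> cg ch x; apply: cvgB; [exact: cg|exact: ch]. Qed.

Lemma contcst (a : R) : continuous ((fun=> a) : T -> R).
Proof. by move=> x; exact: cvg_cst. Qed.

Lemma contZ (a : R) g : continuous g -> continuous (fun x => a * g x).
Proof. by move=> cg; apply: contM => //; exact: contcst. Qed.

Lemma contmin g h : continuous g -> continuous h ->
  continuous (fun x => Num.min (g x) (h x)).
Proof.
by move=> cg ch x; apply: (@continuous_min _ _ g h); [exact: cg|exact: ch].
Qed.

Lemma contmax g h : continuous g -> continuous h ->
  continuous (fun x => Num.max (g x) (h x)).
Proof.
by move=> cg ch x; apply: (@continuous_max _ _ g h); [exact: cg|exact: ch].
Qed.

Lemma compact_bounded_continuous (Q : set T) g : compact Q -> continuous g ->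
  exists M, forall x, Q x -> `|g x| <= M.
Proof.
move=> Qc cg; have /compact_bounded : compact (g @` Q).
  by apply: continuous_compact => //; exact: continuous_subspaceT.
move=> [M [_ /(_ (M + 1))]]; rewrite ltrDl ltr01 => /(_ isT) H.
by exists (M + 1) => x Qx; apply: H; exists x.
Qed.

End ContinuousOperations.

(** [u] is the distance to the complement of [U], which is 1-Lipschitz, or the constant 1 if that
    complement is empty. *)
Lemma open_positive_set {R : realType} {V : normedModType R} (U : set V) :
  open U -> exists u : V -> R,
    [/\ continuous u, forall x, 0 <= u x & forall x, U x <-> 0 < u x].
Proof.
move=> oU; have [[y0 y0U]|U0] := pselect (exists y, ~ U y); last first.
  exists (fun=> 1); split => //; first exact: contcst.
  by move=> x; split => // _; apply: contra_notP U0 => Ux; exists x.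
pose S (x : V) := [set `|x - y| | y in ~` U].
have hS x : has_inf (S x).
  by split; [exists `|x - y0|, y0|exists 0 => _ [y _ <-]].
have S0 x : 0 <= inf (S x).
  by apply: lb_le_inf; [case: (hS x)|move=> _ [y _ <-]].
have Slip x z : inf (S x) <= `|x - z| + inf (S z).
  rewrite -lerBlDl; apply: lb_le_inf; first by case: (hS z).
  move=> _ [y yU <-]; rewrite lerBlDl; apply: (@le_trans _ _ `|x - y|).
    by apply: ge_inf; [case: (hS x)|exists y].
  exact: ler_distD.
exists (fun x => inf (S x)); split => //.
- move=> x; apply/cvgrPdist_le => /= e e0; near=> z.
  have xz : `|x - z| <= e by near: z; exact: cvgr_dist_le.
  rewrite ler_norml; have := Slip x z; have := Slip z x.
  by rewrite distrC; lra.
- move=> x; split => [Ux|]; last first.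
    apply: contraPP => Ux; apply/negP; rewrite -leNgt.
    by apply: ge_inf; [case: (hS x)|exists x => //; rewrite subrr normr0].
  have /nbhs_ballP[e /= e0 xeU] : nbhs x U by exact: open_nbhs_nbhs.
  apply: (lt_le_trans e0); apply: lb_le_inf; first by case: (hS x).
  move=> _ [y yU <-]; rewrite leNgt; apply/negP => xye; apply: yU; apply: xeU.
  by rewrite -ball_normE.
Unshelve. all: by end_near. Qed.

Section RieszMarkov.
Context {R : realType} {V : normedModType R}.
Variables (Q : set V) (Lam : (V -> R) -> R).
Hypothesis Qcompact : compact Q.
Hypothesis LamD : forall g h : V -> R, continuous g -> continuous h ->
  Lam (g \+ h) = Lam g + Lam h.
Hypothesis LamZ : forall (a : R) (g : V -> R), continuous g ->
  Lam (fun x => a * g x) = a * Lam g.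
Hypothesis Lam_ge0 : forall g : V -> R, continuous g ->
  (forall x, Q x -> 0 <= g x) -> 0 <= Lam g.

(* Lets [//] close these goals by assumption. *)
Let continuous_cst (a : R) : continuous ((fun=> a) : V -> R).
Proof. exact: contcst. Qed.

Lemma Lam_sub (g h : V -> R) : continuous g -> continuous h ->
  Lam (fun x => g x - h x) = Lam g - Lam h.
Proof.
move=> cg ch; rewrite -[- Lam h]mulN1r -LamZ// -LamD//; last exact: contZ.
by congr Lam; apply/funext => x /=; rewrite mulN1r.
Qed.

(** Positivity is tested on [Q] only, so [Lam] sees a continuous function only through its
    restriction to [Q]. *)
Lemma le_Lam (g h : V -> R) : continuous g -> continuous h ->
  (forall x, Q x -> g x <= h x) -> Lam g <= Lam h.
Proof.
move=> cg ch gh; rewrite -subr_ge0 -Lam_sub//; apply: Lam_ge0; first exact: contB.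
by move=> x Qx; rewrite subr_ge0 gh.
Qed.

Lemma Lam_cst (a : R) : Lam (fun=> a) = a * Lam (fun=> 1).
Proof. by rewrite -LamZ//; congr Lam; apply/funext => x; rewrite mulr1. Qed.

Lemma Lam_sum (I : Type) (r : seq I) (F : I -> V -> R) :
  (forall i, continuous (F i)) ->
  continuous (fun x => \sum_(i <- r) F i x) /\
  Lam (fun x => \sum_(i <- r) F i x) = \sum_(i <- r) Lam (F i).
Proof.
move=> cF; elim: r => [|i r [cr ih]].
  have -> : (fun x => \sum_(i <- [::]) F i x) = (fun=> 0) :> (V -> R).
    by apply/funext => x; rewrite big_nil.
  by split => //; rewrite Lam_cst mul0r big_nil.
have -> : (fun x => \sum_(j <- i :: r) F j x) =
    F i \+ (fun x => \sum_(j <- r) F j x).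
  by apply/funext => x; rewrite big_cons.
by split; [exact: contD|rewrite LamD// ih big_cons].
Qed.

(* An increasing sequence is used instead of a series of nonnegative functions:
   countable subadditivity then needs only a diagonal sum, and the cost is a
   real number. *)
Definition covering (A : set V) (c : R) (g : nat -> V -> R) :=
  [/\ forall n, continuous (g n), forall n x, 0 <= g n x,
      forall n x, g n x <= g n.+1 x,
      forall x, A x -> Q x -> exists n, 1 <= g n x &
      forall n, Lam (g n) <= c].

(** Coverings have to reach 1 only at points of [Q], so the part of [A] outside [Q] costs
    nothing. *)
Definition cost (A : set V) : R := inf [set c | exists g, covering A c g].

Let homo_covering (g : nat -> V -> R) : (forall n x, g n x <= g n.+1 x) ->
  forall m n x, (m <= n)%N -> g m x <= g n x.
Proof.
move=> gi m n x mn.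
exact: (@homo_leq _ (g ^~ x) (fun a b => a <= b) lexx le_trans (gi ^~ x)).
Qed.

Lemma covering_cst (A : set V) (g : V -> R) : continuous g ->
  (forall x, 0 <= g x) -> (forall x, A x -> Q x -> 1 <= g x) ->
  covering A (Lam g) (fun=> g).
Proof. by move=> cg g0 g1; split => // x Ax Qx; exists 0%N; exact: g1. Qed.

Let covering_ge0 A c g : covering A c g -> 0 <= c.
Proof.
case=> cg g0 _ _ /(_ 0%N); apply: le_trans.
by apply: Lam_ge0 => // x _; exact: g0.
Qed.

Lemma has_inf_cost A : has_inf [set c | exists g, covering A c g].
Proof.
split; last by exists 0 => c [g /covering_ge0].
by exists (Lam (fun=> 1)), (fun=> fun=> 1); apply: covering_cst.
Qed.

Lemma cost_le A c g : covering A c g -> cost A <= c.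
Proof. by move=> gc; apply: ge_inf; [case: (has_inf_cost A)|exists g]. Qed.

Lemma le_cost A a : (forall c g, covering A c g -> a <= c) -> a <= cost A.
Proof.
by move=> ac; apply: lb_le_inf => [|c [g /ac]//]; case: (has_inf_cost A).
Qed.

Lemma cost_ge0 A : 0 <= cost A.
Proof. by apply: le_cost => c g /covering_ge0. Qed.

Lemma cost_le_cst (A : set V) (g : V -> R) : continuous g ->
  (forall x, Q x -> 0 <= g x) -> (forall x, A x -> Q x -> 1 <= g x) ->
  cost A <= Lam g.
Proof.
move=> cg g0 g1.
(* [covering] asks for nonnegativity everywhere, and [g] has it on [Q] only: truncate at 0. *)
have cm : continuous (fun x => Num.max (g x) 0) by exact: contmax.
apply: (@le_trans _ _ (Lam (fun x => Num.max (g x) 0))).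
  apply: cost_le; apply: covering_cst => // x; first by rewrite le_max lexx orbT.
  by move=> Ax Qx; rewrite le_max g1.
by apply: le_Lam => // x Qx; rewrite ge_max lexx g0.
Qed.

Lemma cost_disjoint (A : set V) : (forall x, A x -> ~ Q x) -> cost A = 0.
Proof.
move=> AQ; apply/eqP; rewrite eq_le cost_ge0 andbT.
have <- : Lam (fun=> 0) = 0 by rewrite Lam_cst mul0r.
by apply: cost_le_cst => // x /AQ.
Qed.

(** * The outer measure defined by the cost *)

Definition outer (A : set V) : \bar R := (cost A)%:E.

Let outer0 : outer set0 = 0%E.
Proof. by rewrite /outer cost_disjoint. Qed.

Let outer_ge0 A : (0 <= outer A)%E.
Proof. by rewrite lee_fin cost_ge0. Qed.

Let le_outer : {homo outer : A B / A `<=` B >-> (A <= B)%E}.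
Proof.
move=> A B AB; rewrite lee_fin; apply: le_cost => c g [cg g0 gi g1 gc].
by apply: (@cost_le _ _ g); split => // x /AB; exact: g1.
Qed.

Let outer_sigma_subadditive : sigma_subadditive outer.
Proof.
move=> A; apply/lee_addgt0Pr => e e0.
apply: le_trans (epsilon_trick xpredT _ (ltW e0)) => //.
set S := limn _.
have [Sy|] := ltP S +oo%E; last by rewrite leye_eq => /eqP ->; rewrite leey.
have dlt i : 0 < e / (2 ^ i.+1)%:R by rewrite divr_gt0// ltr0n expn_gt0.
have u0 i : (0 <= outer (A i) + (e / (2 ^ i.+1)%:R)%:E)%E.
  by rewrite adde_ge0// lee_fin ltW.
have S0 : (0 <= S)%E by exact: nneseries_ge0.
have Sfin : S \is a fin_num by rewrite ge0_fin_numE.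
have exg i : exists g, covering (A i) (cost (A i) + e / (2 ^ i.+1)%:R) g.
  have [c [g [cg g0 gi g1 gc]] cle] := inf_adherent (dlt i) (has_inf_cost (A i)).
  by exists g; split => // n; exact: le_trans (gc n) (ltW cle).
have [g gP] := choice exg.
rewrite -(fineK Sfin) lee_fin.
(* Diagonal sum: the [n]-th function adds the [n]-th terms of the coverings of [A 0], ..., [A n],
   and its [Lam] is bounded by a partial sum of the series [S]. *)
apply: (@cost_le _ _ (fun n x => \sum_(0 <= i < n.+1) g i n x)); split.
- by move=> n; apply: (proj1 (Lam_sum _ _)) => i; case: (gP i).
- by move=> n x; apply: sumr_ge0 => i _; case: (gP i).
- move=> n x; rewrite [leRHS]big_nat_recr//= -[leLHS]addr0; apply: lerD.
    by apply: ler_sum => i _; case: (gP i).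
  by case: (gP n.+1).
- move=> x [i _ Aix] Qx; have [_ g0 gi g1 _] := gP i.
  (* The index is at least [i], so that [g i] occurs in the sum, and at least [m], so that it has
     reached 1. *)
  have [m gm] := g1 x Aix Qx; exists (maxn i m); apply: (le_trans gm).
  rewrite (bigD1_seq i) ?mem_index_iota ?iota_uniq ?ltnS ?leq_maxl//=.
  rewrite -[leLHS]addr0; apply: lerD; last first.
    by apply: sumr_ge0 => j _; case: (gP j).
  by apply: homo_covering => //; exact: leq_maxr.
- move=> n; rewrite (proj2 (Lam_sum _ _)); last by move=> i; case: (gP i).
  rewrite -lee_fin fineK//.
  apply: (le_trans _ (nneseries_lim_ge n.+1 (fun i _ _ => u0 i))).
  rewrite sumEFin lee_fin; apply: ler_sum => i _; by case: (gP i).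
Qed.

HB.instance Definition _ := isOuterMeasure.Build R V outer
  outer0 outer_ge0 le_outer outer_sigma_subadditive.

(** The functions [h k] increase to the indicator of [U] and split a covering [g] of [X]: the
    products [g n * h n] cover [X] inside [U], and for a fixed [J] the [g n * (1 - h J)] cover [X]
    outside [U], where [h J] vanishes. The two costs add up to at most [c + e] once [J] nearly
    attains the supremum of the [Lam (G n)]. *)
Lemma open_caratheodory (U : set V) : open U -> outer.-caratheodory U.
Proof.
move=> /open_positive_set[u [cu u0 Uu]].
pose h (k : nat) x := Num.min 1 (k%:R * u x).
have ch k : continuous (h k) by apply: contmin => //; exact: contZ.
have h0 k x : 0 <= h k x by rewrite le_min ler01 mulr_ge0.
have h1 k x : h k x <= 1 by rewrite ge_min lexx.
have hi k x : h k x <= h k.+1 x.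
  by rewrite le_min2// ler_wpM2r// ler_nat.
apply: le_caratheodory_measurable => X; rewrite lee_fin.
apply: le_cost => c g [cg g0 gi g1 gc].
pose G n x := g n x * h n x.
have cG n : continuous (G n) by exact: contM.
have LG n m : Lam (fun x => g n x * h m x) <= c.
  apply: le_trans (gc n); apply: le_Lam => //; first exact: contM.
  by move=> x _; rewrite ler_piMr.
pose S := range (fun n => Lam (G n)).
have hS : has_sup S.
  by split; [exists (Lam (G 0%N)), 0%N|exists c => _ [n _ <-]; exact: LG].
apply/ler_addgt0Pr => e e0.
have [_ [J _ <-] aJ] := sup_adherent e0 hS.
have -> : c + e = sup S + (c + e - sup S) by rewrite addrCA subrr addr0.
apply: lerD.
  apply: (@cost_le _ _ G); split => //.
  - by move=> n x; rewrite mulr_ge0.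
  - by move=> n x; apply: ler_pM.
  - move=> x [Xx /Uu ux] Qx; have [n gn] := g1 x Xx Qx.
    have [k uk] : exists k : nat, 1 <= k%:R * u x.
      exists (Num.truncn (u x)^-1).+1.
      by rewrite -ler_pdivrMr// mul1r ltW// truncnS_gt.
    exists (maxn n k); rewrite -[1]mulr1; apply: ler_pM => //.
      by apply: (le_trans gn); apply: homo_covering => //; exact: leq_maxl.
    rewrite le_min lexx/=; apply: (le_trans uk).
    by rewrite ler_wpM2r// ler_nat leq_maxr.
  - by move=> n; apply: ub_le_sup; [case: hS|exists n].
have cgJ n : continuous (fun x => g n x * (1 - h J x)).
  by apply: contM => //; exact: contB.
have gJi n x : g n x * (1 - h J x) <= g n.+1 x * (1 - h J x).
  by rewrite ler_wpM2r// subr_ge0.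
apply: (@cost_le _ _ (fun n x => g n x * (1 - h J x))); split => //.
- by move=> n x; rewrite mulr_ge0// subr_ge0.
- move=> x [Xx Ux] Qx; have [n gn] := g1 x Xx Qx; exists n.
  have ux : u x = 0.
    by apply/eqP; rewrite eq_le u0 andbT leNgt; apply/negP => /Uu.
  by rewrite /h ux mulr0 min_r// subr0 mulr1.
- move=> n; apply: (@le_trans _ _ (Lam (fun x => g (maxn n J) x * (1 - h J x)))).
    apply: le_Lam => // x _; rewrite ler_wpM2r ?subr_ge0//.
    by apply: homo_covering => //; exact: leq_maxl.
  have -> : (fun x => g (maxn n J) x * (1 - h J x)) =
      (fun x => g (maxn n J) x - g (maxn n J) x * h J x).
    by apply/funext => x; rewrite mulrBr mulr1.
  rewrite Lam_sub//; last exact: contM.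
  have : Lam (G J) <= Lam (fun x => g (maxn n J) x * h J x).
    apply: le_Lam => //; first exact: contM.
    move=> x _; rewrite ler_wpM2r//.
    by apply: homo_covering => //; exact: leq_maxr.
  by move: (gc (maxn n J)) aJ; lra.
Qed.

(** * Restriction to a Borel measure and its total mass *)

Local Notation borelV := (g_sigma_algebraType (@open V)).

Lemma borel_caratheodory (A : set borelV) : measurable A -> outer.-caratheodory A.
Proof.
apply: smallest_sub; last exact: open_caratheodory.
exact: (@sigma_algebra_measurable _ (caratheodory_type outer)).
Qed.

Definition riesz_measure (A : set borelV) : \bar R := outer A.

Let riesz_measure0 : riesz_measure set0 = 0%E. Proof. exact: outer0. Qed.

Let riesz_measure_ge0 A : (0 <= riesz_measure A)%E. Proof. exact: outer_ge0. Qed.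

Let riesz_measure_sigma_additive : semi_sigma_additive riesz_measure.
Proof.
move=> F mF tF mUF.
apply: (@caratheodory_measure_sigma_additive R V outer F) => //.
- by move=> i; exact: borel_caratheodory.
- exact: borel_caratheodory.
Qed.

HB.instance Definition _ := measure_function.isMeasure.Build _ borelV R riesz_measure
  riesz_measure0 riesz_measure_ge0 riesz_measure_sigma_additive.

(** The lower bound is Dini's argument: a covering of the whole space increases and reaches 1 at
    each point of the compact set [Q], so some [g n] exceeds [1 - d] on all of [Q], and [Lam (g n)]
    is at least [1 - d] times [Lam (fun=> 1)]. *)
Lemma cost_setT : cost setT = Lam (fun=> 1).
Proof.
apply/eqP; rewrite eq_le; apply/andP; split; first exact: cost_le_cst.
apply: le_cost => c g [cg g0 gi g1 gc].
apply/ler_addgt0Pr => e e0.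
have L0 : 0 <= Lam (fun=> 1) by exact: Lam_ge0.
have [d d0 dL] : exists2 d, 0 < d & d * Lam (fun=> 1) <= e.
  exists (e / (1 + Lam (fun=> 1))); first by rewrite divr_gt0// ltr_wpDr.
  by rewrite mulrAC ler_pdivrMr ?ltr_wpDr// ler_pM2l// ler_wpDl.
have : \forall n \near \oo, Q `<=` [set x | 1 - d < g n x].
  apply: (proj1 (compact_near_coveringP Q) Qcompact nat \oo
    (fun n x => 1 - d < g n x)) => x Qx.
  have [m gm] := g1 x I Qx.
  have /cvgr_gt/(_ (1 - d)) gx : g m y @[y --> x] --> g m x by exact: cg.
  exists ([set y | 1 - d < g m y], [set n | (m <= n)%N]).
    by split; [apply: gx; lra|exact: nbhs_infty_ge].
  move=> [y n] /= [gmy mn]; apply: (lt_le_trans gmy).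
  exact: homo_covering.
case=> n _ /(_ n (leqnn n)) ng.
have : Lam (fun=> 1 - d) <= Lam (g n).
  by apply: le_Lam => // x /ng/= /ltW.
by rewrite Lam_cst; move: (gc n) dL; lra.
Qed.

Lemma measurable_open (A : set V) : open A -> measurable (A : set borelV).
Proof. by move=> oA; exact: sub_sigma_algebra. Qed.

Lemma measurable_closed (A : set V) : closed A -> measurable (A : set borelV).
Proof.
by move=> cA; rewrite -[A]setCK; apply: measurableC; apply: measurable_open;
  exact: closed_openC.
Qed.

Lemma measurable_continuous (D : set borelV) (g : V -> R) : continuous g ->
  measurable_fun D (g : borelV -> R).
Proof.
move=> /continuousP cg; apply: measurable_funTS.
apply: (measurability _ (RGenOpens.measurableE R)).
move=> _ [_ [a [b ->] <-]]; rewrite setTI; apply: measurable_open.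
exact/cg/interval_open.
Qed.

(** * Regularity of the cost *)

Lemma costU A B : cost (A `|` B) <= cost A + cost B.
Proof. by have := outer_measureU2 outer A B; rewrite lee_fin. Qed.

Lemma costS A B : A `<=` B -> cost A <= cost B.
Proof. by move=> /(le_outer_measure outer); rewrite lee_fin. Qed.

Lemma costC : cost (~` Q) = 0.
Proof. exact: cost_disjoint. Qed.

Lemma costI A : cost (A `&` Q) = cost A.
Proof.
apply/eqP; rewrite eq_le; apply/andP; split; first by apply: costS => x [].
rewrite -[leRHS]addr0 -costC; apply: le_trans (costU _ _); apply: costS => x Ax.
by have [Qx|Qx] := pselect (Q x); [left|right].
Qed.

(** In a nearly optimal covering [g], the points where some [g n] exceeds a threshold [t < 1] form
    an open set, and rescaling [g] by [t^-1] covers it at cost [t^-1 * c]. *)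
Lemma cost_outer_regular (A : set V) (e : R) : 0 < e ->
  exists U : set V, [/\ open U, A `&` Q `<=` U & cost U <= cost A + e].
Proof.
move=> e0; have e4 : 0 < e / 4 by lra.
have [c [g gc] cA] := inf_adherent e4 (has_inf_cost A).
have c0 := covering_ge0 gc; case: gc => cg g0 gi g1 gc.
(* Chosen so that [t < 1] even if [c = 0], while [t * (c + e / 2) = c + e / 4] is at least [c]. *)
pose t := (c + e / 4) / (c + e / 2).
have t0 : 0 < t by apply: divr_gt0; lra.
have t1 : t < 1 by rewrite ltr_pdivrMr; lra.
exists (\bigcup_n [set x | t < g n x]); split.
- apply: bigcup_open => n _; have /continuousP/(_ `]t, +oo[%classic) := cg n.
  have -> : [set x | t < g n x] = g n @^-1` `]t, +oo[%classic.
    by apply/seteqP; split => x /=; rewrite in_itv/= andbT.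
  by apply; exact: interval_open.
- move=> x [Ax Qx]; have [n gn] := g1 x Ax Qx; exists n => //=.
  exact: lt_le_trans gn.
- apply: (@le_trans _ _ (t^-1 * c)).
    apply: (@cost_le _ _ (fun n x => t^-1 * g n x)); split.
    + by move=> n; exact: contZ.
    + by move=> n x; rewrite mulr_ge0// invr_ge0 ltW.
    + by move=> n x; rewrite ler_pM2l// invr_gt0.
    + move=> x [n _ /= tg] _; exists n.
      by rewrite mulrC ler_pdivlMr// mul1r ltW.
    + by move=> n; rewrite LamZ// ler_pM2l// invr_gt0.
  rewrite ler_pdivrMl//; apply: (@le_trans _ _ (t * (c + e / 2))).
    by rewrite divfK; lra.
  by rewrite ler_pM2l//; lra.
Qed.

(** Take an open [U] nearly optimal for the complement of [A], and the compact set [Q] minus [U]. As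
    [A] splits [U] additively, what is lost, namely [U] intersected with [A], costs at most [e]. *)
Lemma cost_inner_regular (A : set borelV) (e : R) : measurable A -> 0 < e ->
  exists C : set V, [/\ compact C, C `<=` A & cost A <= cost C + e].
Proof.
move=> mA e0; have [U [oU AU Ue]] := cost_outer_regular (~` A) e0.
exists (Q `&` ~` U); split.
- by apply: compact_closedI => //; exact: open_closedC.
- by move=> x [Qx Ux]; apply: contrapT => Ax; exact/Ux/AU.
have := borel_caratheodory mA U; rewrite /outer -EFinD => -[UA].
have AC : cost (~` A) <= cost (U `&` ~` A).
  by rewrite -costI; apply: costS => x [Ax Qx]; split => //; exact: AU.
have : cost A <= cost (Q `&` ~` U) + cost (U `&` A).
  rewrite -costI; apply: le_trans (costU _ _); apply: costS => x [Ax Qx].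
  by have [Ux|Ux] := pselect (U x); [right|left].
by move: UA Ue AC; lra.
Qed.

(** * Integrals of continuous functions *)

Let mQ : measurable (Q : set borelV).
Proof. by apply: measurable_closed; exact: compact_closed. Qed.

Let integrable_continuous (g : V -> R) : continuous g ->
  riesz_measure.-integrable Q (EFin \o g).
Proof.
move=> cg; apply: measurable_bounded_integrable => //; first exact: ltry.
  exact: measurable_continuous.
have [M gM] := compact_bounded_continuous Qcompact cg.
exists M; split => [|x Mx y Qy]; first exact: num_real.
exact: le_trans (gM y Qy) (ltW Mx).
Qed.

Local Notation I g := (Rintegral riesz_measure Q g).

Let integral_step (g : V -> R) (A : set borelV) (d : R) : 0 <= d ->
  continuous g -> measurable A -> (forall x, Q x -> g x <= d * \1_A x) ->
  I g <= d * cost A.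
Proof.
move=> d0 cg mA gA.
have iA : riesz_measure.-integrable Q (EFin \o (\1_A : borelV -> R)).
  apply: measurable_bounded_integrable => //; first exact: ltry.
  exists 1; split => // M M1 x _ /=; rewrite ger0_norm ?indic_ge0//.
  by rewrite indicE (le_trans _ (ltW M1))//; case: (_ \in _).
apply: (@le_trans _ _ (I (fun x => d * \1_A x))).
  apply: le_Rintegral => //; first exact: integrable_continuous.
  exact: (integrableZl mQ d iA).
rewrite RintegralZl// ler_wpM2l//.
by rewrite /Rintegral integral_indic//= -[leRHS]costI.
Qed.

(** Layer-cake argument: cut [g] into layers [D] of height [d]. The integral of a layer is at most
    [d] times the cost of its base, and its [Lam] is at least [d] times the cost of its top; the
    differences telescope to at most [d * Lam (fun=> 1)]. *)
Let integral_le (g : V -> R) : continuous g -> (forall x, Q x -> 0 <= g x) ->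
  I g <= Lam g.
Proof.
move=> cg g0.
have cmin a : continuous (fun x => Num.min (g x) a) by exact: contmin.
have L0 : 0 <= Lam (fun=> 1) by exact: Lam_ge0.
have arith (a b c x y z d L : R) : a <= b + d * (L - x) -> c <= d * x ->
    d * y <= z -> a + c <= b + z + d * (L - y).
  by rewrite !mulrBr; lra.
(* The error term is the telescoped sum of the differences between base and top; it is zero for
   [m = 0], as the set then contains [Q]. *)
have main d m : 0 < d -> I (fun x => Num.min (g x) (m%:R * d)) <=
    Lam (fun x => Num.min (g x) (m%:R * d)) +
    d * (Lam (fun=> 1) - cost [set x | m%:R * d <= g x]).
  move=> d0; elim: m => [|m ih].
    have -> : cost [set x | 0%:R * d <= g x] = Lam (fun=> 1).
      rewrite -cost_setT -[RHS]costI -costI; congr cost.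
      apply/seteqP; split=> x [/= _ Qx]; split => //=.
      by rewrite mul0r g0.
    rewrite subrr mulr0 addr0 (@eq_Rintegral _ _ _ _ _ (fun=> 0)).
      rewrite Rintegral_cst// mul0r; apply: Lam_ge0 => // x Qx.
      by rewrite mul0r le_min lexx g0.
    by move=> x /set_mem Qx; rewrite mul0r min_r// g0.
  pose D x := Num.min (g x) (m.+1%:R * d) - Num.min (g x) (m%:R * d).
  have cD : continuous D by exact: contB.
  have md : m%:R * d <= m.+1%:R * d by rewrite ler_pM2r// ler_nat.
  have mdS : m.+1%:R * d = m%:R * d + d by rewrite -natr1 mulrDl mul1r.
  have mset k : measurable ([set x | k <= g x] : set borelV).
    apply: measurable_closed.
    have -> : [set x | k <= g x] = g @^-1` `[k, +oo[%classic.
      by apply/seteqP; split => x /=; rewrite in_itv/= andbT.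
    by move/continuous_closedP : cg; apply; exact: interval_closed.
  have IS : I (fun x => Num.min (g x) (m.+1%:R * d)) =
      I (fun x => Num.min (g x) (m%:R * d)) + I D.
    rewrite -RintegralD//; [|exact: integrable_continuous..].
    by apply: eq_Rintegral => x _; rewrite addrC subrK.
  have ID : I D <= d * cost [set x | m%:R * d <= g x].
    apply: integral_step => //; first exact: ltW.
    move=> x Qx; rewrite /D indicE.
    have [gx|gx] := leP (m%:R * d) (g x).
      rewrite mem_set//= mulr1 lerBlDl -mdS ge_min lexx orbT//.
    rewrite memNset/=; last by apply/negP; rewrite -ltNge.
    by rewrite mulr0 min_l ?subrr// (le_trans (ltW gx)).
  have LD : d * cost [set x | m.+1%:R * d <= g x] <= Lam D.
    rewrite -ler_pdivlMl// -LamZ//; apply: cost_le_cst => //.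
    - exact: contZ.
    - move=> x Qx; rewrite mulr_ge0 ?invr_ge0 ?(ltW d0)// subr_ge0 le_min2//.
    - move=> x /= gx Qx; rewrite ler_pdivlMl// mulr1 /D.
      by rewrite (min_r gx) min_r ?(le_trans md)// mdS addrAC subrr add0r.
  have LS : Lam (fun x => Num.min (g x) (m.+1%:R * d)) =
      Lam (fun x => Num.min (g x) (m%:R * d)) + Lam D.
    by rewrite -LamD//; congr Lam; apply/funext => x /=; rewrite addrC subrK.
  by rewrite IS LS; exact: arith ih ID LD.
have [M gM'] := compact_bounded_continuous Qcompact cg.
have gM x : Q x -> g x <= M by move=> /gM'; exact: le_trans (ler_norm _).
apply/ler_addgt0Pr => e e0.
pose d := e / (1 + Lam (fun=> 1)).
have d0 : 0 < d by rewrite divr_gt0// ltr_wpDr.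
have dL : d * Lam (fun=> 1) <= e.
  by rewrite mulrAC ler_pdivrMr ?ltr_wpDr// ler_pM2l// ler_wpDl.
pose m := (Num.truncn (M / d)).+1.
have gm x : Q x -> Num.min (g x) (m%:R * d) = g x.
  move=> Qx; rewrite min_l// (le_trans (gM x Qx))// -ler_pdivrMr//.
  by rewrite ltW// truncnS_gt.
have := main d m d0.
have -> : I (fun x => Num.min (g x) (m%:R * d)) = I g.
  by apply: eq_Rintegral => x /set_mem /gm.
move=> /le_trans; apply; apply: lerD.
  by apply: le_Lam => // x /gm ->.
apply: le_trans dL; rewrite ler_pM2l// gerBl; exact: cost_ge0.
Qed.

(** The one-sided bound [integral_le] for [M + g] and [M - g], both nonnegative on [Q], gives the
    two inequalities; for constants equality holds by [cost_setT]. *)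
Lemma integral_riesz_measure (g : V -> R) : continuous g ->
  riesz_measure.-integrable Q (EFin \o g) /\
  (\int[riesz_measure]_(x in Q) (g x)%:E = (Lam g)%:E)%E.
Proof.
move=> cg; split; first exact: integrable_continuous.
suff <- : I g = Lam g.
  by rewrite /Rintegral fineK//; apply: integrable_fin_num => //;
    exact: integrable_continuous.
have [M gM] := compact_bounded_continuous Qcompact cg.
have c1 a : continuous ((fun=> a) : V -> R) by exact: contcst.
have IM : I (fun=> M) = Lam (fun=> M).
  rewrite Rintegral_cst// Lam_cst -cost_setT -[in RHS]costI setTI.
  by congr (_ * _).
have h1 : I (fun x => M + g x) <= Lam (fun x => M + g x).
  apply: integral_le; first exact: contD.
  by move=> x /gM; rewrite ler_norml; lra.
have h2 : I (fun x => M - g x) <= Lam (fun x => M - g x).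
  apply: integral_le; first exact: contB.
  by move=> x /gM; rewrite ler_norml; lra.
move: h1 h2; rewrite RintegralD ?RintegralB//; try exact: integrable_continuous.
rewrite Lam_sub// (LamD (c1 M) cg) IM => h1 h2.
by apply/eqP; rewrite eq_le; apply/andP; split; move: h1 h2; lra.
Qed.

End RieszMarkov.

Theorem riesz_markov {R : realType} {V : normedModType R} (Q : set V)
    (Lam : (V -> R) -> R) :
  compact Q ->
  (forall g h : V -> R, continuous g -> continuous h ->
    Lam (g \+ h) = Lam g + Lam h) ->
  (forall (a : R) (g : V -> R), continuous g ->
    Lam (fun x => a * g x) = a * Lam g) ->
  (forall g : V -> R, continuous g -> (forall x, Q x -> 0 <= g x) ->
    0 <= Lam g) ->
  exists mu : {measure set (g_sigma_algebraType (@open V)) -> \bar R},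
    [/\ (mu setT < +oo)%E, mu (~` Q) = 0%E,
      forall A : set (g_sigma_algebraType (@open V)), measurable A ->
        mu A = ereal_sup [set mu C | C in
                 [set C : set V | compact C /\ C `<=` A]] &
      forall g : V -> R, continuous g -> mu.-integrable Q (EFin \o g) /\
        (\int[mu]_(x in Q) (g x)%:E = (Lam g)%:E)%E].
Proof.
move=> Qc LD LZ L0.
exists (@riesz_measure R V Q Lam); split.
- exact: ltry.
- by rewrite /= /riesz_measure /outer costC//.
- move=> A mA; apply/eqP; rewrite eq_le; apply/andP; split; last first.
    apply: ge_ereal_sup => _ [C [_ CA] <-]; rewrite lee_fin.
    exact: costS.
  apply/lee_addgt0Pr => e e0.
  have [C [Cc CA Ce]] := cost_inner_regular Qc LD LZ L0 mA e0.
  apply: (@le_trans _ _ ((cost Q Lam C)%:E + e%:E)%E); first by rewrite lee_fin.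
  by rewrite leeD2r//; apply: ereal_sup_ubound; exists C.
- by move=> g cg; exact: integral_riesz_measure.
Unshelve. all: by []. Qed.

(** * Polynomials and preorderings *)

(** Used to push an ultrafilter on indices forward to the real line, where a compact segment then
    provides a limit. *)
Lemma ultra_fmap (T U : Type) (f : T -> U) (F : set_system T) :
  UltraFilter F -> UltraFilter (f @ F).
Proof.
move=> FU; split; first exact: fmap_proper_filter.
move=> G GF FG; apply/seteqP; split => // A GA.
have [//|FA] := in_ultra_setVsetC (f @^-1` A) FU.
have GnA : G (~` A) by exact: FG.
by have /filter_ex [? []] : G (A `&` ~` A) by exact: filterI.
Qed.

Section Evaluation.
Context {R : realType} {d : nat}.
Implicit Types (p q : {mpoly R[d]}) (x : 'rV[R]_d).

Lemma evalpC (c : R) x : evalp (mpolyC d c) x = c.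
Proof. exact: mevalC. Qed.

Lemma evalpX i x : evalp (mpolyX R (mnm1 i)) x = x ord0 i.
Proof. exact: mevalXU. Qed.

Lemma evalpD p q x : evalp (p + q) x = evalp p x + evalp q x.
Proof. exact: mevalD. Qed.

Lemma evalpB p q x : evalp (p - q) x = evalp p x - evalp q x.
Proof. exact: mevalB. Qed.

Lemma evalpM p q x : evalp (p * q) x = evalp p x * evalp q x.
Proof. exact: mevalM. Qed.

Lemma evalp_exp p n x : evalp (p ^+ n) x = evalp p x ^+ n.
Proof. exact: rmorphXn. Qed.

Lemma mpoly_algebra_ind (P : {mpoly R[d]} -> Prop) :
  (forall c, P (mpolyC d c)) -> (forall i, P (mpolyX R (mnm1 i))) ->
  (forall p q, P p -> P q -> P (p + q)) ->
  (forall p q, P p -> P q -> P (p * q)) -> forall p, P p.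
Proof.
move=> PC PX PD PM; elim/mpolyind => [|c m p _ _ Pp]; first by rewrite -mpolyC0.
apply: PD => //; rewrite -mul_mpolyC; apply: (PM) => //; rewrite mpolyXE_id.
apply: big_ind; [by rewrite -mpolyC1|exact: PM|move=> i _].
by elim: (m i) => [|k ih]; [rewrite expr0 -mpolyC1|rewrite exprS; exact: PM].
Qed.

Lemma continuous_evalp p : continuous (evalp p).
Proof.
elim/mpoly_algebra_ind : p => [c|i|p q cp cq|p q cp cq].
- have -> : evalp (mpolyC d c) = fun=> c by apply/funext => x; rewrite evalpC.
  exact: contcst.
- have -> : evalp (mpolyX R (mnm1 i)) = fun x => x ord0 i.
    by apply/funext => x; rewrite evalpX.
  exact: (@coord_continuous R 1 d ord0 i).
- have -> : evalp (p + q) = fun x => evalp p x + evalp q x.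
    by apply/funext => x; rewrite evalpD.
  exact: contD.
- have -> : evalp (p * q) = fun x => evalp p x * evalp q x.
    by apply/funext => x; rewrite evalpM.
  exact: contM.
Qed.

Lemma scalar_mpolyC (L : {scalar {mpoly R[d]}}) c p :
  L (mpolyC d c * p) = c * L p.
Proof. by rewrite mul_mpolyC linearZ. Qed.

End Evaluation.

(** * Sums of squares and preorderings *)

Section PreorderingClosure.
Context {R : realType} {d : nat}.
Implicit Types (p q : {mpoly R[d]}).

Lemma sosM p q : sos p -> sos q -> sos (p * q).
Proof.
move=> [s ->] [t ->]; exists [seq a * b | a <- s, b <- t].
rewrite big_allpairs_dep mulr_suml; apply: eq_bigr => a _.
by rewrite mulr_sumr; apply: eq_bigr => b _; rewrite exprMn.
Qed.

Lemma sosD p q : sos p -> sos q -> sos (p + q).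
Proof. by move=> [s ->] [t ->]; exists (s ++ t); rewrite big_cat. Qed.

Lemma sos0 : sos (0 : {mpoly R[d]}).
Proof. by exists [::]; rewrite big_nil. Qed.

Lemma sos_sqr p : sos (p ^+ 2).
Proof. by exists [:: p]; rewrite big_seq1. Qed.

Context {s : nat} (f : 'I_s -> {mpoly R[d]}).

Lemma preorderingD p q : preordering f p -> preordering f q ->
  preordering f (p + q).
Proof.
move=> [u su ->] [v sv ->]; exists (fun e => u e + v e) => [e|].
  exact: sosD.
by rewrite -big_split; apply: eq_bigr => e _; rewrite mulrDl.
Qed.

Lemma preordering_term p (e : {ffun 'I_s -> bool}) : sos p ->
  preordering f (p * \prod_(i < s) f i ^+ e i).
Proof.
move=> sp; exists (fun e' => if e' == e then p else 0) => [e'|].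
  by case: ifP => // _; exact: sos0.
rewrite (bigD1 e)//= eqxx [X in _ + X]big1 ?addr0// => e' /negPf ->.
by rewrite mul0r.
Qed.

Lemma preordering_sum (I : Type) (r : seq I) (F : I -> {mpoly R[d]}) :
  (forall i, preordering f (F i)) -> preordering f (\sum_(i <- r) F i).
Proof.
move=> H; elim/big_ind : _ => //; last exact: preorderingD.
exists (fun=> 0); first by move=> _; exact: sos0.
by rewrite big1// => e _; rewrite mul0r.
Qed.

Lemma preorderingM p q : preordering f p -> preordering f q ->
  preordering f (p * q).
Proof.
move=> [u su ->] [v sv ->]; rewrite mulr_suml; apply: preordering_sum => e.
rewrite mulr_sumr; apply: preordering_sum => e'.
(* [g] collects the [f i] occurring in both products; once its square is extracted, the exclusive or
   of the exponents remains. *)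
pose g := \prod_(i < s) f i ^+ (e i && e' i).
have -> : u e * \prod_(i < s) f i ^+ e i * (v e' * \prod_(i < s) f i ^+ e' i) =
    (u e * v e' * g ^+ 2) *
    \prod_(i < s) f i ^+ [ffun i => e i (+) e' i] i.
  rewrite mulrACA -[RHS]mulrA; congr (_ * _).
  rewrite /g expr2 -!big_split/=; apply: eq_bigr => i _; rewrite ffunE.
  by case: (e i); case: (e' i); rewrite /= ?expr0 ?expr1 ?mulr1 ?mul1r.
by apply: preordering_term; apply: sosM; [exact: sosM|exact: sos_sqr].
Qed.

Lemma preordering_sqr p : preordering f (p ^+ 2).
Proof.
have := preordering_term [ffun=> false] (sos_sqr p).
by rewrite big1 ?mulr1// => i _; rewrite ffunE.
Qed.

Lemma preordering_gen i : preordering f (f i).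
Proof.
have := preordering_term [ffun j => j == i] (sos_sqr 1).
rewrite expr1n mul1r (bigD1 i)//= ffunE eqxx expr1 big1 ?mulr1//.
by move=> j /negPf ji; rewrite ffunE ji.
Qed.

End PreorderingClosure.

(** * Extension of a positive functional to continuous functions *)

Section ArchimedeanPreordering.
Context {R : realType} {d : nat}.
Variable T : set {mpoly R[d]}.
Hypothesis TD : forall p q, T p -> T q -> T (p + q).
Hypothesis TM : forall p q, T p -> T q -> T (p * q).
Hypothesis Tsqr : forall p, T (p ^+ 2).
Implicit Types p q : {mpoly R[d]}.

Local Notation C := (mpolyC d).
Local Notation X i := (mpolyX R (mnm1 i)).

Lemma preorder_mpolyC (c : R) : 0 <= c -> T (C c).
Proof.
by move=> c0; rewrite -(sqr_sqrtr c0) expr2 mpolyCM -expr2; exact: Tsqr.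
Qed.

Lemma preorder0 : T 0. Proof. by rewrite -mpolyC0; exact: preorder_mpolyC. Qed.

Lemma preorder1 : T 1. Proof. by rewrite -(expr1n _ 2); exact: Tsqr. Qed.

Lemma preorder_sum (I : eqType) (r : seq I) (P : pred I) (F : I -> {mpoly R[d]}) :
  (forall i, i \in r -> P i -> T (F i)) -> T (\sum_(i <- r | P i) F i).
Proof.
move=> TF; rewrite big_seq_cond; apply: big_ind; [exact: preorder0|exact: TD|].
by move=> i /andP[]; exact: TF.
Qed.

(* Coin tossing: the weights are the Bernstein polynomials
   'C(m, k) s^k (1 - s)^(m - k), with multiplicity, and the three sums are the
   moments of order at most 2 of the binomial distribution. *)
Lemma bernstein_partition (s : {mpoly R[d]}) (m : nat) : T s -> T (1 - s) ->
  exists W : seq ({mpoly R[d]} * nat),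
    [/\ forall w, w \in W -> T w.1 /\ (w.2 <= m)%N,
      \sum_(w <- W) w.1 = 1,
      \sum_(w <- W) w.1 * (m%:R * s - w.2%:R) = 0 &
      \sum_(w <- W) w.1 * (m%:R * s - w.2%:R) ^+ 2 = m%:R * s * (1 - s)].
Proof.
move=> Ts Ts1; elim: m => [|m [W [WT W0 W1 W2]]].
  exists [:: (1, 0%N)]; rewrite !big_seq1/= mulr0n.
  split; [|by []|ring|ring].
  by move=> w; rewrite inE => /eqP -> /=; split => //; exact: preorder1.
exists ([seq (w.1 * s, w.2.+1) | w <- W] ++ [seq (w.1 * (1 - s), w.2) | w <- W]).
rewrite !big_cat !big_map/= -!big_split/=; split.
- move=> w; rewrite mem_cat => /orP[] /mapP[v /WT[Tv vm] ->] /=.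
    by split; [exact: TM|rewrite ltnS].
  by split; [exact: TM|exact: leqW].
- by rewrite -[RHS]W0; apply: eq_bigr => w _; ring.
- rewrite -[RHS]W1; apply: eq_bigr => w _; rewrite -!natr1; ring.
- transitivity (\sum_(w <- W) w.1 * (m%:R * s - w.2%:R) ^+ 2 +
      s * (1 - s) * \sum_(w <- W) w.1).
    rewrite mulr_sumr -big_split; apply: eq_bigr => w _ /=.
    by rewrite -!natr1; ring.
  by rewrite W0 W2 -natr1; ring.
Qed.

(** The substitution [s = (lam + p) / (2 * lam)] turns the binomial variance into
    [(lam ^+ 2 - p ^+ 2) / m]. Modulo [T] this is at most [lam ^+ 2 / m], as squares lie in [T], and
    [m] is chosen to keep that bound below [e]. *)
Lemma interval_partition (p : {mpoly R[d]}) (lam e : R) : 0 < lam -> 0 < e ->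
  T (C lam + p) -> T (C lam - p) ->
  exists W : seq ({mpoly R[d]} * R),
    [/\ forall w, w \in W -> T w.1 /\ `|w.2| <= lam,
      \sum_(w <- W) w.1 = 1 &
      T (C e - \sum_(w <- W) w.1 * (p - C w.2) ^+ 2)].
Proof.
move=> l0 e0 Tp Tm.
pose m := (Num.truncn (lam ^+ 2 / e)).+1.
have m0 : m%:R != 0 :> R by rewrite pnatr_eq0.
have [s es] : exists s, s = C (2 * lam)^-1 * (C lam + p) by eexists.
have l20 : 2 * lam != 0 by rewrite mulf_neq0// ?gt_eqF// pnatr_eq0.
have s1 : 1 - s = C (2 * lam)^-1 * (C lam - p).
  have -> : 1 = C (2 * lam)^-1 * (C lam + C lam) :> {mpoly R[d]}.
    by rewrite -mpolyCD -mpolyCM -mpolyC1; congr C; field; rewrite gt_eqF.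
  by rewrite es; ring.
have Ti : T (C (2 * lam)^-1) by apply: preorder_mpolyC; rewrite invr_ge0 mulr_ge0// ltW.
have Ts : T s by rewrite es; exact: TM.
have Ts1 : T (1 - s) by rewrite s1; exact: TM.
have [W [WT W0 _ W2]] := bernstein_partition m Ts Ts1.
pose y (k : nat) : R := lam * (2 * k%:R / m%:R - 1).
have ey k : p - C (y k) = C (2 * lam / m%:R) * (m%:R * s - k%:R).
  have -> : p = C (2 * lam) * s - C lam.
    by rewrite es mulrA -mpolyCM divff// mpolyC1; ring.
  have -> : y k = 2 * lam / m%:R * k%:R - lam by rewrite /y; field.
  rewrite mulrBr -(mpolyC_nat d R m) -(mpolyC_nat d R k) mulrA -!mpolyCM divfK//.
  by rewrite mpolyCB; ring.
exists [seq (w.1, y w.2) | w <- W]; rewrite !big_map; split => //.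
- move=> w /mapP[v /WT[Tv vm] ->] /=; split => //.
  rewrite /y normrM (gtr0_norm l0); apply: ler_piMr; first exact: ltW.
  have : v.2%:R / m%:R <= 1 :> R by rewrite ler_pdivrMr ?ltr0n// mul1r ler_nat.
  have : 0 <= v.2%:R / m%:R :> R by rewrite divr_ge0.
  by rewrite ler_norml -mulrA; lra.
- have -> : \sum_(w <- W) w.1 * (p - C (y w.2)) ^+ 2 =
      C (m%:R^-1) * (C (lam ^+ 2) - p ^+ 2).
    transitivity (C (2 * lam / m%:R) ^+ 2 * (m%:R * s * (1 - s))).
      rewrite -W2 mulr_sumr; apply: eq_bigr => w _; rewrite ey; ring.
    rewrite s1 es -(mpolyC_nat d R m).
    transitivity (C (2 * lam / m%:R) ^+ 2 * C m%:R *
        C (2 * lam)^-1 * C (2 * lam)^-1 * (C lam ^+ 2 - p ^+ 2)); first by ring.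
    rewrite [C lam ^+ 2]expr2 [C (2 * lam / _) ^+ 2]expr2 -!mpolyCM.
    by congr (C _ * _); field; rewrite (gt_eqF l0) m0.
  have -> : C e - C m%:R^-1 * (C (lam ^+ 2) - p ^+ 2) =
      C (e - m%:R^-1 * lam ^+ 2) + C m%:R^-1 * p ^+ 2.
    by rewrite mpolyCB mpolyCM; ring.
  apply: TD; last by apply: TM => //; apply: preorder_mpolyC; rewrite invr_ge0.
  apply: preorder_mpolyC; rewrite subr_ge0 mulrC ler_pdivrMr ?ltr0n//.
  by rewrite -ler_pdivrMl// mulrC ltW// truncnS_gt.
Qed.

(** * Partitions of unity on the cube *)

Variable lam : 'I_d -> R.
Hypothesis lam_gt0 : forall i, 0 < lam i.
Hypothesis TXD : forall i, T (C (lam i) + X i).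
Hypothesis TXB : forall i, T (C (lam i) - X i).

Definition cube : set 'rV[R]_d := [set x | forall i, `|x ord0 i| <= lam i].

Lemma cube_compact : compact cube.
Proof.
have -> : cube = [set x : 'rV[R]_d | forall i, `[- lam i, lam i]%classic (x ord0 i)].
  by apply/seteqP; split => x /= xQ i; have := xQ i; rewrite in_itv/= ler_norml.
apply: (@rV_compact R d (fun i => `[- lam i, lam i]%classic)) => i.
exact: segment_compact.
Qed.

(** Multiply the one-dimensional partitions, one coordinate at a time. Refining in a new coordinate
    keeps the earlier estimates, because the new weights sum to 1 and the earlier coordinates of the
    nodes do not change. *)
Lemma cube_partition (e : R) : 0 < e ->
  exists W : seq ({mpoly R[d]} * 'rV[R]_d),
    [/\ forall w, w \in W -> T w.1 /\ cube w.2,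
      \sum_(w <- W) w.1 = 1 &
      forall i, T (C e - \sum_(w <- W) w.1 * (X i - C (w.2 ord0 i)) ^+ 2)].
Proof.
move=> e0.
suff /(_ d) [W [WT W1 We]] : forall n, exists W : seq ({mpoly R[d]} * 'rV[R]_d),
    [/\ forall w, w \in W -> T w.1 /\ cube w.2,
      \sum_(w <- W) w.1 = 1 &
      forall i : 'I_d, (i < n)%N ->
        T (C e - \sum_(w <- W) w.1 * (X i - C (w.2 ord0 i)) ^+ 2)].
  by exists W; split => // i; exact: We.
elim=> [|n [W [WT W1 We]]].
  exists [:: (1, 0)]; rewrite big_seq1; split => // w; rewrite inE => /eqP -> /=.
  by split; [exact: preorder1|move=> i; rewrite mxE normr0 ltW].
have [dn|nd] := leqP d n.
  by exists W; split => // i _; apply: We; exact: leq_trans dn.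
pose i0 := Ordinal nd.
have [V [VT V1 Ve]] := interval_partition (lam_gt0 i0) e0 (TXD i0) (TXB i0).
pose upd (y : 'rV[R]_d) (z : R) : 'rV[R]_d :=
  \row_j (if j == i0 then z else y ord0 j).
exists [seq (w.1 * v.1, upd w.2 v.2) | w <- W, v <- V]; split.
- move=> _ /allpairsP[[w v] [/= /WT[Tw Qw] /VT[Tv zv] ->]] /=.
  split; first exact: TM.
  by move=> j; rewrite mxE; case: eqP => [->|_].
- rewrite big_allpairs_dep/= -[RHS]W1; apply: eq_bigr => w _.
  by rewrite -mulr_sumr V1 mulr1.
- move=> i; rewrite ltnS leq_eqVlt big_allpairs_dep/=.
  have [-> _|ii0] := eqVneq i i0.
    suff -> : \sum_(w <- W) \sum_(v <- V)
        w.1 * v.1 * (X i0 - C (upd w.2 v.2 ord0 i0)) ^+ 2 =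
        \sum_(v <- V) v.1 * (X i0 - C v.2) ^+ 2 by [].
    rewrite -[RHS]mul1r -W1 mulr_suml; apply: eq_bigr => w _.
    by rewrite mulr_sumr; apply: eq_bigr => v _; rewrite mxE eqxx mulrA.
  have /negPf -> : i != n :> nat.
    by apply: contra ii0 => /eqP /esym ni; apply/eqP/val_inj.
  move=> /= /We.
  suff -> : \sum_(w <- W) \sum_(v <- V)
      w.1 * v.1 * (X i - C (upd w.2 v.2 ord0 i)) ^+ 2 =
      \sum_(w <- W) w.1 * (X i - C (w.2 ord0 i)) ^+ 2 by [].
  apply: eq_bigr => w _; rewrite -[RHS]mulr1 -V1 mulr_sumr.
  by apply: eq_bigr => v _; rewrite mxE (negPf ii0) mulrAC.
Qed.

(** * Lipschitz bounds modulo [T] *)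

Definition sqdist (y : 'rV[R]_d) : {mpoly R[d]} :=
  \sum_(i < d) (X i - C (y ord0 i)) ^+ 2.

Lemma preorder_sqdist y : T (sqdist y).
Proof. by apply: preorder_sum => i _ _; exact: Tsqr. Qed.

(** The hypotheses on [u] read as [|u| <= a] modulo [T], and likewise for [q] and [b]. The product
    bound comes from writing [2 * (a * b + u * q)] as [(a + u) * (b + q) + (a - u) * (b - q)], and
    similarly for the difference. *)
Let preorder_mul_abs (a b u q : {mpoly R[d]}) : T (a + u) -> T (a - u) ->
  T (b + q) -> T (b - q) -> T (a * b + u * q) /\ T (a * b - u * q).
Proof.
move=> ua ub qa qb; have T2 : T (C 2^-1) by apply: preorder_mpolyC; rewrite invr_ge0.
have half p : p = C 2^-1 * (p + p).
  by rewrite mulrDr -mulrDl -mpolyCD -[LHS]mul1r -mpolyC1; congr (C _ * _); field.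
split.
- have -> : a * b + u * q = C 2^-1 * ((a + u) * (b + q) + (a - u) * (b - q)).
    by rewrite [LHS]half; ring.
  by apply: TM => //; apply: TD; exact: TM.
- have -> : a * b - u * q = C 2^-1 * ((a - u) * (b + q) + (a + u) * (b - q)).
    by rewrite [LHS]half; ring.
  by apply: TM => //; apply: TD; exact: TM.
Qed.

Hypothesis Tarch : is_archimedean T.

(** [e + e^-1 * sqdist y] is a polynomial substitute for the distance to [y], which it dominates for
    every [e > 0]; [K] depends neither on [y] nor on [e]. For a product, write [p q - p(y) q(y)] as
    [(p - p(y)) q + p(y) (q - q(y))], where [q] is bounded by the Archimedean property and [p(y)] by
    compactness of the cube. *)
Lemma preorder_lipschitz p : exists2 K : R, 0 <= K &
  forall y (e : R), cube y -> 0 < e ->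
    T (C K * (C e + C e^-1 * sqdist y) + (p - C (evalp p y))) /\
    T (C K * (C e + C e^-1 * sqdist y) - (p - C (evalp p y))).
Proof.
have Te y e : 0 < e -> T (C e + C e^-1 * sqdist y).
  move=> e0; apply: TD; first by apply: preorder_mpolyC; exact: ltW.
  by apply: TM; [apply: preorder_mpolyC; rewrite invr_ge0 ltW|exact: preorder_sqdist].
elim/(@mpoly_algebra_ind R d) : p =>
  [c|i|p q [K K0 pK] [M M0 qM]|p q [K K0 pK] [M M0 qM]].
- exists 0 => // y e _ e0; rewrite evalpC subrr mpolyC0 mul0r addr0 subr0.
  by split; exact: preorder0.
- exists 1 => // y e _ e0; rewrite evalpX mpolyC1 mul1r.
  set u := X i - _.
  have -> : sqdist y = u ^+ 2 + \sum_(j < d | j != i) (X j - C (y ord0 j)) ^+ 2.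
    by rewrite /sqdist (bigD1 i).
  set q := \sum_(j < d | _) _.
  have Tq : T q by apply: preorder_sum => j _ _; exact: Tsqr.
  have ee : C e * C e^-1 = 1 by rewrite -mpolyCM divff ?gt_eqF// mpolyC1.
  (* The constants complete the square: [e + u ^+ 2 / e + u] equals
     [3 / 4 * e + (u + e / 2) ^+ 2 / e], and likewise for [- u]. *)
  have e34 : C e = C (3 / 4 * e) + C (2^-1 ^+ 2) * C e.
    by rewrite -mpolyCM -mpolyCD; congr C; field.
  have h : C 2^-1 + C 2^-1 = 1 :> {mpoly R[d]}.
    by rewrite -mpolyCD -mpolyC1; congr C; field.
  have Ti : T (C e^-1) by apply: preorder_mpolyC; rewrite invr_ge0 ltW.
  have T34 : T (C (3 / 4 * e)).
    by apply: preorder_mpolyC; rewrite mulr_ge0// ?ltW// divr_ge0.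
  have h2 : C (2^-1 ^+ 2) = C 2^-1 * C 2^-1 :> {mpoly R[d]} by rewrite expr2 mpolyCM.
  split.
  + have -> : C e + C e^-1 * (u ^+ 2 + q) + u =
        C (3 / 4 * e) + C e^-1 * (u + C 2^-1 * C e) ^+ 2 + C e^-1 * q.
      rewrite {1}e34 h2.
      transitivity (C (3 / 4 * e) + C e^-1 * u ^+ 2 + (C 2^-1 + C 2^-1) * u *
          (C e * C e^-1) + C 2^-1 * C 2^-1 * C e * (C e * C e^-1) + C e^-1 * q);
        last by ring.
      by rewrite ee h; ring.
    by apply: TD; [apply: TD => //; apply: TM|exact: TM].
  + have -> : C e + C e^-1 * (u ^+ 2 + q) - u =
        C (3 / 4 * e) + C e^-1 * (u - C 2^-1 * C e) ^+ 2 + C e^-1 * q.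
      rewrite {1}e34 h2.
      transitivity (C (3 / 4 * e) + C e^-1 * u ^+ 2 - (C 2^-1 + C 2^-1) * u *
          (C e * C e^-1) + C 2^-1 * C 2^-1 * C e * (C e * C e^-1) + C e^-1 * q);
        last by ring.
      by rewrite ee h; ring.
    by apply: TD; [apply: TD => //; apply: TM|exact: TM].
- exists (K + M); first exact: addr_ge0.
  move=> y e Qy e0; have [p1 p2] := pK y e Qy e0; have [q1 q2] := qM y e Qy e0.
  rewrite evalpD !mpolyCD; split.
  + by have := TD p1 q1; congr T; ring.
  + by have := TD p2 q2; congr T; ring.
- have [B B0 [qB1 qB2]] := Tarch q.
  have [N pN] := compact_bounded_continuous cube_compact (continuous_evalp (p := p)).
  have N0 : 0 <= `|N| by [].
  exists (K * B + `|N| * M); first by rewrite addr_ge0// mulr_ge0// ltW.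
  move=> y e Qy e0; have [p1 p2] := pK y e Qy e0; have [q1 q2] := qM y e Qy e0.
  have [u1 u2] := preorder_mul_abs p1 p2 qB1 qB2.
  have pyN : `|evalp p y| <= `|N| by exact: le_trans (pN y Qy) (ler_norm _).
  have [v1 v2] : T (C `|N| + C (evalp p y)) /\ T (C `|N| - C (evalp p y)).
    move: pyN; rewrite ler_norml -mpolyCD -mpolyCB => pyN.
    by split; apply: preorder_mpolyC; lra.
  have [w1 w2] := preorder_mul_abs q1 q2 v1 v2.
  rewrite evalpM mpolyCD !mpolyCM; split.
  + by have := TD u1 w1; congr T; ring.
  + by have := TD u2 w2; congr T; ring.
Qed.

(** * Averages over the nodes and their limit *)

Variable L : {scalar {mpoly R[d]}}.
Hypothesis L_ge0 : positive_on T L.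

(** The integral of [g] for the discrete measure with mass [L w.1] at each node [w.2]. *)
Definition average (W : seq ({mpoly R[d]} * 'rV[R]_d)) (g : 'rV[R]_d -> R) : R :=
  \sum_(w <- W) g w.2 * L w.1.

(** The Lipschitz bound at a node, multiplied by its weight, stays in [T], so [L] may be applied and
    the results summed; the squared distances contribute at most [r * d%:R * L 1]. The parameter [e]
    stays free, to be balanced against [r]. *)
Lemma average_error p : exists2 K : R, 0 <= K &
  forall W (r e : R), (forall w, w \in W -> T w.1 /\ cube w.2) ->
    \sum_(w <- W) w.1 = 1 ->
    (forall i, T (C r - \sum_(w <- W) w.1 * (X i - C (w.2 ord0 i)) ^+ 2)) ->
    0 < e ->
    `|L p - average W (evalp p)| <= K * (e + e^-1 * (r * d%:R)) * L 1.
Proof.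
have [K K0 pK] := preorder_lipschitz p; exists K => // W r e WT W1 We e0.
have sqW : \sum_(w <- W) L (w.1 * sqdist w.2) <= r * d%:R * L 1.
  have -> : \sum_(w <- W) L (w.1 * sqdist w.2) =
      \sum_(i < d) L (\sum_(w <- W) w.1 * (X i - C (w.2 ord0 i)) ^+ 2).
    under [RHS]eq_bigr do rewrite linear_sum.
    rewrite exchange_big/=; apply: eq_bigr => w _.
    by rewrite /sqdist mulr_sumr linear_sum.
  have -> : r * d%:R * L 1 = \sum_(i < d) L (C r).
    by rewrite sumr_const card_ord -[C r]mulr1 scalar_mpolyC -[RHS]mulr_natr mulrAC.
  by apply: ler_sum => i _; rewrite -subr_ge0 -linearB; exact/L_ge0/We.
pose v (w : {mpoly R[d]} * 'rV[R]_d) :=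
  K * (e * L w.1 + e^-1 * L (w.1 * sqdist w.2)).
have sv : \sum_(w <- W) v w <= K * (e + e^-1 * (r * d%:R)) * L 1.
  rewrite -mulr_sumr big_split/= -!mulr_sumr -linear_sum W1 -mulrA mulrDl.
  by rewrite ler_wpM2l// lerD2l -mulrA ler_wpM2l// invr_ge0 ltW.
apply: le_trans sv.
have -> : L p - average W (evalp p) =
    \sum_(w <- W) (L (w.1 * p) - evalp p w.2 * L w.1).
  by rewrite sumrB -linear_sum -mulr_suml W1 mul1r.
apply: le_trans (ler_norm_sum _ _ _) _.
rewrite big_seq [leRHS]big_seq; apply: ler_sum => -[b y] /WT[/= Tb Qy].
have [h1 h2] := pK y e Qy e0.
have {h1} := L_ge0 (TM Tb h1); have {h2} := L_ge0 (TM Tb h2).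
have -> : b * (C K * (C e + C e^-1 * sqdist y) - (p - C (evalp p y))) =
    C K * (C e * b + C e^-1 * (b * sqdist y)) - (b * p - C (evalp p y) * b).
  by ring.
have -> : b * (C K * (C e + C e^-1 * sqdist y) + (p - C (evalp p y))) =
    C K * (C e * b + C e^-1 * (b * sqdist y)) + (b * p - C (evalp p y) * b).
  by ring.
rewrite !raddfD !raddfN /v /= !scalar_mpolyC !raddfD /= !scalar_mpolyC.
rewrite ler_norml => h2 h1.
by apply/andP; split; lra.
Qed.

(** The averages of a continuous function are bounded by a bound of it on the cube times [L 1], so
    they converge along an ultrafilter, and such limits inherit linearity and positivity. On
    polynomials [average_error] gives convergence to [L p]. *)
Lemma positive_extension : exists Lam : ('rV[R]_d -> R) -> R,
  [/\ forall g h : 'rV[R]_d -> R, continuous g -> continuous h ->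
      Lam (g \+ h) = Lam g + Lam h,
    forall (a : R) (g : 'rV[R]_d -> R), continuous g ->
      Lam (fun x => a * g x) = a * Lam g,
    forall g : 'rV[R]_d -> R, continuous g ->
      (forall x, cube x -> 0 <= g x) -> 0 <= Lam g &
    forall p, Lam (evalp p) = L p].
Proof.
have [W WP] := choice (fun n : nat =>
  cube_partition (divr_gt0 ltr01 (ltr0Sn R n))).
pose A n g := average (W n) g.
(* The ultrafilter refines convergence at infinity, so ordinary limits of sequences are also limits
   along it. *)
have [U [UU oU]] := ultraFilterLemma (eventually_filter : ProperFilter \oo).
have L1 : 0 <= L 1 by exact/L_ge0/preorder1.
have A_ge0 n (g : 'rV[R]_d -> R) : (forall x, cube x -> 0 <= g x) -> 0 <= A n g.
  move=> g0; rewrite /A /average big_seq; apply: sumr_ge0 => w.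
  case: (WP n) => WT _ _ /WT[Tw Qw].
  by rewrite mulr_ge0//; [exact: g0|exact: L_ge0].
have AB n (g : 'rV[R]_d -> R) (M : R) :
    (forall x, cube x -> `|g x| <= M) -> `|A n g| <= M * L 1.
  move=> gM; have [WT W1 _] := WP n.
  have -> : M * L 1 = \sum_(w <- W n) M * L w.1.
    by rewrite -mulr_sumr -linear_sum W1.
  apply: le_trans (ler_norm_sum _ _ _) _.
  rewrite big_seq [leRHS]big_seq; apply: ler_sum => w /WT[Tw Qw].
  rewrite normrM (ger0_norm (L_ge0 Tw)) ler_wpM2r ?gM//; exact: L_ge0.
have cvgA (g : 'rV[R]_d -> R) : continuous g -> cvg (A n g @[n --> U]).
  move=> cg; have [M gM] := compact_bounded_continuous cube_compact cg.
  have := @segment_compact R (- (M * L 1)) (M * L 1).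
  rewrite compact_ultra => /(_ ((fun n => A n g) @ U)) [].
  - exact: ultra_fmap.
  - by apply: (@filterE nat U) => n /=; rewrite in_itv/= -ler_norml; exact: AB.
  - by move=> l [_ /= Ul]; apply/cvg_ex; exists l.
exists (fun g => lim (A n g @[n --> U])); split.
- move=> g h cg ch; apply/cvg_lim => //.
  rewrite (_ : (fun n => A n (g \+ h)) = (fun n => A n g + A n h)).
    by apply: cvgD; exact: cvgA.
  apply/funext => n; rewrite /A /average -big_split.
  by apply: eq_bigr => w _; rewrite mulrDl.
- move=> a g cg; apply/cvg_lim => //.
  rewrite (_ : (fun n => A n _) = (fun n => a * A n g)).
    by apply: cvgM; [exact: cvg_cst|exact: cvgA].
  apply/funext => n; rewrite /A /average mulr_sumr.
  by apply: eq_bigr => w _; rewrite mulrA.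
- move=> g cg g0; apply: limr_ge; first exact: cvgA.
  by apply: filterE => n; exact: A_ge0.
- move=> p; apply/cvg_lim => //; apply: cvg_trans; first exact: (cvg_app _ oU).
  have [K K0 pK] := average_error p.
  apply/cvgrPdist_le => e e0.
  have KL0 : 0 <= K * L 1 by exact: mulr_ge0.
  (* First [r] makes [K * r * L 1] at most [e / 2]; the other term carries the factor [1 / n.+1%:R]
     and is then small for large [n]. *)
  pose r := e / (2 * (1 + K * L 1)).
  have r0 : 0 < r by rewrite divr_gt0// mulr_gt0// ltr_wpDr.
  have rK : K * r * L 1 <= e / 2.
    rewrite /r mulrAC mulrA ler_pdivrMr ?mulr_gt0 ?ltr_wpDr//.
    have -> : e / 2 * (2 * (1 + K * L 1)) = K * L 1 * e + e by field.
    by rewrite lerDl ltW.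
  near=> n.
  have [WT W1 We] := WP n.
  apply: le_trans (pK _ _ _ WT W1 We r0) _.
  have -> : e = e / 2 + e / 2 by field.
  rewrite mulrDr mulrDl lerD//.
  have -> : K * (r^-1 * (1 / n.+1%:R * d%:R)) * L 1 =
      (K * r^-1 * d%:R * L 1) / n.+1%:R.
    by field; rewrite nat1r pnatr_eq0 (gt_eqF r0).
  rewrite ler_pdivrMr ?ltr0n// [leRHS]mulrC -ler_pdivrMr ?divr_gt0//.
  apply: (@le_trans _ _ n%:R); last by rewrite ler_nat.
  near: n; exact: nbhs_infty_ger.
Unshelve. all: by end_near. Qed.

End ArchimedeanPreordering.

(** * The support of the representing measure *)

Lemma bernoulli_unbounded {R : realType} (a b : R) : 0 < a ->
  exists n : nat, b <= (1 + a) ^+ n.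
Proof.
move=> a0; have bern n : 1 + n%:R * a <= (1 + a) ^+ n.
  elim: n => [|n ih]; first by rewrite mul0r addr0 expr0.
  have naa : 0 <= n%:R * (a * a) by rewrite !mulr_ge0// ltW.
  have : (1 + a) * (1 + n%:R * a) <= (1 + a) ^+ n.+1.
    by rewrite exprS ler_wpM2l// addr_ge0// ltW.
  apply: le_trans; rewrite -natr1.
  have -> : (1 + a) * (1 + n%:R * a) =
    1 + (n%:R + 1) * a + n%:R * (a * a) by ring.
  by rewrite lerDl.
exists (Num.truncn (b / a)).+1; apply: le_trans (bern _).
by rewrite -lerBlDl (le_trans (y := b)) ?gerBl// -ler_pdivrMr// ltW// truncnS_gt.
Qed.

(* Since [g * q ^+ 2] has nonnegative integral for every [q], take [q] a high
   power of [1 - g / M]: it is at most [1] where [g >= 0] and huge where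
   [g <= - eta]. *)
Lemma test_polynomial {R : realType} {d : nat} (g : {mpoly R[d]})
    (M eta e : R) : 0 < M -> 0 < eta -> 0 < e ->
  exists (c : R) (q : {mpoly R[d]}), 0 <= c /\
    forall x, `|evalp g x| <= M ->
      0 <= e - c * evalp (g * q ^+ 2) x /\
      (evalp g x <= - eta -> 1 <= e - c * evalp (g * q ^+ 2) x).
Proof.
move=> M0 n0 e0; have a0 : 0 < eta / M by rewrite divr_gt0.
have [n tn] := bernoulli_unbounded (M / (eta * e)) a0.
set t := 1 + eta / M in tn.
have t1 : 1 <= t by rewrite lerDl ltW.
have t0 : 0 < t by exact: lt_le_trans t1.
have tn1 : 1 <= t ^+ n by rewrite exprn_ege1.
have tn0 : 0 < t ^+ n by rewrite exprn_gt0.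
pose T2 := (t ^+ n) ^+ 2.
have T20 : 0 < T2 by rewrite exprn_gt0.
have T2n : M / (eta * e) <= T2.
  by apply: (le_trans tn); rewrite /T2 expr2 ler_peMl// ltW.
(* Normalized so that [c * eta * T2 = 1]: this yields the bound 1 where [g <= - eta], and the choice
   of [n] gives [c * M <= e] for the region where [g] is positive. *)
pose c := (eta * T2)^-1.
have c0 : 0 < c by rewrite invr_gt0 mulr_gt0.
exists c, ((mpolyC d 1 - mpolyC d M^-1 * g) ^+ n); split; first exact: ltW.
move=> x; rewrite evalpM !evalp_exp evalpB evalpM !evalpC.
set y := evalp g x; rewrite ler_norml => /andP[yl yu].
set z := (1 - M^-1 * y) ^+ n ^+ 2.
have z0 : 0 <= z by rewrite sqr_ge0.
have yM : - 1 <= M^-1 * y <= 1.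
  by rewrite ler_pdivlMl// mulrN1 yl ler_pdivrMl// mulr1 yu.
have neg : y <= - eta -> 1 <= - (c * (y * z)).
  move=> yeta.
  have tz : T2 <= z.
    have h : t <= 1 - M^-1 * y.
      rewrite /t lerD2l mulrC -mulrN ler_pM2l ?invr_gt0//; lra.
    by rewrite /z /T2 ler_sqr ?nnegrE ?exprn_ge0 ?(le_trans _ h) ?(ltW t0)//;
      apply: lerXn2r => //; rewrite nnegrE ?(ltW t0)// (le_trans (ltW t0) h).
  rewrite -[1](mulVf (x := eta * T2)); last by rewrite gt_eqF// mulr_gt0.
  rewrite -mulrN -mulNr ler_pM2l//; apply: ler_pM => //; [exact: ltW|exact: ltW|lra].
have [y0|y0] := leP y 0.
  have h : 0 <= - (c * (y * z)).
    by rewrite -mulrN -mulNr mulr_ge0 ?(ltW c0)// mulr_ge0// oppr_ge0.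
  by split => [|/neg h1]; lra.
have z1 : z <= 1.
  rewrite /z -(expr1n _ 2) ler_sqr ?nnegrE ?exprn_ge0//; last by case/andP: yM; lra.
  rewrite exprn_ile1//; first by case/andP: yM; lra.
  by have : 0 <= M^-1 * y; [rewrite mulr_ge0 ?invr_ge0 ?ltW|lra].
have cM : c * M <= e.
  rewrite /c ler_pdivrMl ?mulr_gt0//.
  by move: T2n; rewrite ler_pdivrMr ?mulr_gt0//; lra.
split; last by lra.
rewrite subr_ge0; apply: le_trans cM; rewrite ler_pM2l//.
by rewrite -[leRHS]mulr1; apply: ler_pM => //; exact: ltW.
Qed.

(** The set is exhausted by the traces on [Q] of the sets [A n]. On [Q] the polynomial [u], built
    with [test_polynomial], dominates the indicator of [A n], while [L u <= e] because
    [L (g * q ^+ 2)] is nonnegative; hence each trace is null. *)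
Lemma localizing_support {R : realType} {d : nat} (Q : set 'rV[R]_d)
    (mu : {measure set (borelRd R d) -> \bar R}) (L : {scalar {mpoly R[d]}})
    (g : {mpoly R[d]}) :
  compact Q -> measurable (Q : set (borelRd R d)) -> (mu setT < +oo)%E ->
  (forall p, mu.-integrable Q (EFin \o evalp p) /\
    (\int[mu]_(x in Q) (evalp p x)%:E = (L p)%:E)%E) ->
  (forall q, 0 <= L (g * q ^+ 2)) ->
  mu.-negligible (Q `&` [set x | evalp g x < 0]).
Proof.
move=> Qc mQ mufin intL Lg.
have cg := continuous_evalp (p := g).
have [M gM'] := compact_bounded_continuous Qc cg.
have M0 : 0 < `|M| + 1 by rewrite ltr_wpDl.
have gM x : Q x -> `|evalp g x| <= `|M| + 1.
  by move=> /gM' h; rewrite (le_trans h)// (le_trans (ler_norm _))// lerDl.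
pose A (n : nat) : set (borelRd R d) := [set x | evalp g x <= - n.+1%:R^-1].
have mA n : measurable (A n).
  apply: measurable_closed.
  have -> : A n = evalp g @^-1` `]-oo, - n.+1%:R^-1]%classic.
    by apply/seteqP; split => x /=; rewrite in_itv.
  by move/continuous_closedP : cg; apply; exact: interval_closed.
have L1 : 0 <= L 1.
  rewrite -lee_fin -(intL 1).2; apply: integral_ge0 => x _.
  by rewrite lee_fin -mpolyC1 evalpC.
apply: (@negligibleS _ _ _ mu (\bigcup_n (Q `&` A n))).
  move=> x [Qx /= gx]; exists (Num.truncn (- evalp g x)^-1) => //; split => //=.
  have gx0 : 0 < - evalp g x by rewrite oppr_gt0.
  rewrite /A /= lerNr -[leRHS]invrK lef_pV2 ?posrE ?invr_gt0//.
  by rewrite ltW// truncnS_gt.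
apply: negligible_bigcup => n; apply/negligibleP; first exact: measurableI.
apply/eqP; rewrite eq_le measure_ge0 andbT; apply/lee_addgt0Pr => e e0.
rewrite add0e; pose e' := e / (1 + L 1).
have e'0 : 0 < e' by rewrite divr_gt0// ltr_wpDr.
have n0 : 0 < n.+1%:R^-1 :> R by rewrite invr_gt0.
have [c [q [c0 cq]]] := test_polynomial g M0 n0 e'0.
pose u := mpolyC d e' - mpolyC d c * (g * q ^+ 2).
have uE x : evalp u x = e' - c * evalp (g * q ^+ 2) x.
  by rewrite evalpB evalpM !evalpC.
have Lu : L u <= e.
  rewrite raddfB/= -[mpolyC d e']mulr1 !scalar_mpolyC.
  apply: (@le_trans _ _ (e' * L 1)); first by rewrite gerBl mulr_ge0.
  by rewrite mulrAC ler_pdivrMr ?ltr_wpDr// ler_pM2l// ler_wpDl.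
apply: (@le_trans _ _ (L u)%:E); last by rewrite lee_fin.
apply: (@le_trans _ _ (\int[mu]_(x in Q) (\1_(A n) x)%:E)%E).
  by rewrite integral_indic// setIC.
rewrite -(intL u).2.
apply: ge0_le_integral => //.
- exact/measurable_EFinP/measurable_indic.
- apply/measurable_EFinP; apply: measurable_continuous; exact: continuous_evalp.
- move=> x Qx; rewrite lee_fin uE indicE; have [u0 u1] := cq x (gM x Qx).
  by have [/set_mem /u1//|] := boolP (x \in A n).
Qed.

(** * The representing measure on [K(f)] *)

Theorem theorem7p4 (R : realType) (d s : nat) (f : 'I_s -> {mpoly R[d]})
    (hT : is_archimedean (preordering f))
    (L : {scalar {mpoly R[d]}}) (hL : positive_on (preordering f) L) :
  moment_functional (semialg f) L.
Proof.
(* The Archimedean property of each coordinate gives the half-sides of the cube. *)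
have [lam lamP] := choice (fun i : 'I_d =>
  let: ex_intro2 l l0 H := hT (mpolyX R (mnm1 i)) in
  ex_intro (fun l => 0 < l /\ _ /\ _) l (conj l0 H)).
have [Lam [LamD LamZ Lam_ge0 LamE]] := positive_extension
  (@preorderingD _ _ _ f) (@preorderingM _ _ _ f) (@preordering_sqr _ _ _ f)
  (fun i => (lamP i).1) (fun i => (lamP i).2.1) (fun i => (lamP i).2.2) hT hL.
have Qc := @cube_compact R d lam; set Q := cube lam in Qc Lam_ge0.
have [mu [mufin muQ mureg intLam]] := riesz_markov Qc LamD LamZ Lam_ge0.
have mclosed (A : set 'rV[R]_d) : closed A -> measurable (A : set (borelRd R d)).
  exact: measurable_closed.
have mQ : measurable (Q : set (borelRd R d)).
  by apply: mclosed; apply: compact_closed => //; exact: norm_hausdorff.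
have intL p : mu.-integrable Q (EFin \o evalp p) /\
    (\int[mu]_(x in Q) (evalp p x)%:E = (L p)%:E)%E.
  by rewrite -LamE; apply: intLam; exact: continuous_evalp.
have mK : measurable (semialg f : set (borelRd R d)).
  apply: mclosed; rewrite /semialg.
  have -> : [set x | forall i, 0 <= evalp (f i) x] =
      \bigcap_(i : 'I_s) (evalp (f i) @^-1` `[0, +oo[%classic).
    apply/seteqP; split => x /= H i; first by move=> _; rewrite /= in_itv/= H.
    by have := H i I; rewrite /= in_itv/= andbT.
  apply: closed_bigI => i _.
  have /continuous_closedP := continuous_evalp (p := f i); apply.
  exact: interval_closed.
have Knegl : mu.-negligible (~` semialg f).
  (* Indexing by [nat] turns the finite family into a countable union; [F k] is empty for
     [k >= s]. *)
  pose F (k : nat) : set (borelRd R d) :=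
    [set x | exists2 i : 'I_s, val i = k & Q x /\ evalp (f i) x < 0].
  apply: (@negligibleS _ _ _ mu (~` Q `|` \bigcup_k F k)).
    move=> x /existsNP[i /negP]; rewrite -ltNge => fx.
    have [Qx|Qx] := pselect (Q x); last by left.
    by right; exists (val i) => //; exists i.
  apply: negligibleU; first by apply/negligibleP => //; exact: measurableC.
  apply: negligible_bigcup => k; have [ks|sk] := ltnP k s; last first.
    apply: negligibleS (negligible_set0 mu) => x [i ik _].
    by have := ltn_ord i; rewrite /= ik ltnNge sk.
  apply: negligibleS (localizing_support Qc mQ mufin intL (g := f (Ordinal ks)) _).
    move=> x [i ik [Qx fx]]; split => //=.
    by rewrite (_ : Ordinal ks = i)//; exact/val_inj.
  move=> q; apply: hL; apply: preorderingM; first exact: preordering_gen.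
  exact: preordering_sqr.
have muK : mu (~` semialg f) = 0%E.
  by apply: measure_negligible => //; exact: measurableC.
exists mu; split=> //.
- split=> // C Cc; apply: le_lt_trans mufin; apply: le_measure => //; rewrite inE//.
  by apply: mclosed; apply: compact_closed => //; exact: norm_hausdorff.
- move=> p; have [iQ LQ] := intL p.
  (* [Q] and [semialg f] both have null complements, so both integrals reduce to their
     intersection. *)
  have QK : Q `\` ~` semialg f = semialg f `\` ~` Q by rewrite !setDE !setCK setIC.
  have mp D : measurable_fun D (EFin \o evalp p : borelRd R d -> \bar R).
    by apply/measurable_EFinP; apply: measurable_continuous; exact: continuous_evalp.
  have iK : mu.-integrable (semialg f) (EFin \o evalp p).
    apply/(@negligible_integrable _ _ _ mu _ (~` Q)) => //.
      exact: measurableC.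
    rewrite -QK; apply: (proj1 (@negligible_integrable _ _ _ mu Q _ _ _ _ _ _)) => //.
    exact: measurableC.
  split=> //; rewrite -LQ.
  rewrite (@negligible_integral _ _ _ mu Q (~` semialg f))//; last exact: measurableC.
  rewrite QK -negligible_integral//; exact: measurableC.
Qed.
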